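(* Let $\mathcal D_1$ and $\mathcal D_2$ be two commutative, totally ordered, idempotent dioids and $\mathcal A$ a commutative semiring. Then, identifying $(D_1\times D_2)\times A$ with $D_1\times(D_2\times A)$ via $((d_1,d_2),a)\leftrightarrow(d_1,(d_2,a))$, we have $(\mathcal D_1\Delta\mathcal D_2)\Delta\mathcal A=\mathcal D_1\Delta(\mathcal D_2\Delta\mathcal A)$ (same underlying set, same addition, same multiplication, same zero and unit).
   Context: A semiring $(A,+,\times,0,1)$: $(A,+,0)$ commutative monoid, $(A,\times,1)$ monoid, $\times$ distributes over $+$, $0$ absorbing for $\times$, $0\ne1$; commutative if $\times$ is. A dioid is a semiring $(D,\min,+_D,\infty_D,0_D)$ ($\min$ names the additive operation, $+_D$ the multiplicative one) for which $d_1\le_D d_2\iff\exists c,\ \min(d_2,c)=d_1$ is a partial order; idempotent if $\min(d,d)=d$; totally ordered if $\le_D$ is total. An element $d\in D\setminus\{\infty_D\}$ is multiplicatively regular if $d+_Db=d+_Dc\Rightarrow b=c$; $reg(\mathcal D)$ is the set of these. For a commutative totally ordered idempotent dioid $\mathcal D$ and a commutative semiring $\mathcal A=(A,+_A,\times_A,0_A,1_A)$, the delta product is $\mathcal D\Delta\mathcal A=(D\Delta A,\oplus,\otimes,(\infty_D,0_A),(0_D,1_A))$ with $D\Delta A=\{(d,a): d\in reg(\mathcal D)\text{ or }a=0_A\}$, $(d_1,a_1)\oplus(d_2,a_2)=(\min(d_1,d_2),a)$ where $a=a_1$ if $d_1<_Dd_2$, $a=a_2$ if $d_2<_Dd_1$,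 $a=a_1+_Aa_2$ if $d_1=d_2$; and $(d_1,a_1)\otimes(d_2,a_2)=(d_1+_Dd_2,a_1\times_Aa_2)$. In $\mathcal D_1\Delta\mathcal D_2$, $\mathcal D_2$ is regarded as a semiring (addition $\min_2$, multiplication $+_2$); it is known that $\mathcal D_1\Delta\mathcal D_2$ is again a commutative totally ordered idempotent dioid, so $(\mathcal D_1\Delta\mathcal D_2)\Delta\mathcal A$ is defined. *)

(* Defs.v *)
From HB Require Import structures.
From mathcomp Require Import all_boot all_algebra.
From mathcomp Require Import boolp classical_sets.

Set Implicit Arguments.
Unset Strict Implicit.
Unset Printing Implicit Defensive.

Import GRing.Theory.
Local Open Scope ring_scope.

(* A dioid (D, min, +_D, oo_D, 0_D) is a semiring with 0 <> 1, so in ring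
   notation: min is +, +_D is *, oo_D is 0 and 0_D is 1. *)

Definition dioid_le (D : nzSemiRingType) (d1 d2 : D) : Prop :=
  exists c, d2 + c = d1.

Definition dioid_lt (D : nzSemiRingType) (d1 d2 : D) : Prop :=
  dioid_le d1 d2 /\ d1 <> d2.

Definition is_partial_order (T : Type) (le : T -> T -> Prop) : Prop :=
  [/\ forall x, le x x,
      forall x y, le x y -> le y x -> x = y
    & forall x y z, le x y -> le y z -> le x z].

HB.mixin Record NzSemiRing_isDioid D of GRing.NzSemiRing D := {
  dioid_le_po : is_partial_order (@dioid_le D)
}.

#[short(type="dioidType")]
HB.structure Definition Dioid :=
  { D of GRing.NzSemiRing D & NzSemiRing_isDioid D }.

HB.mixin Record Dioid_isTotalIdempotent D of Dioid D := {
  dioid_addxx : forall d : D, d + d = d;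
  dioid_le_total : forall d1 d2 : D, dioid_le d1 d2 \/ dioid_le d2 d1
}.

(* Cti: commutative, totally ordered, idempotent *)
#[short(type="ctiDioidType")]
HB.structure Definition CtiDioid :=
  { D of GRing.ComNzSemiRing D & Dioid D & Dioid_isTotalIdempotent D }.

Definition mregular (D : nzSemiRingType) (d : D) : Prop :=
  d <> 0 /\ forall b c, d * b = d * c -> b = c.

Section DeltaProduct.
Variables (D : ctiDioidType) (A : comNzSemiRingType).
Implicit Types (d : D) (a : A).

Definition delta_mem (x : D * A) : bool := `[< mregular x.1 \/ x.2 = 0 >].

(* a record, so that it does not inherit the componentwise operations of the
   product type D * A *)
Record delta := Delta { delta_val : D * A; deltaP : delta_mem delta_val }.

HB.instance Definition _ := [isSub for delta_val].
HB.instance Definition _ := [Choice of delta by <:].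

(* the order being total, the last branch is the case x.1 = y.1 *)
Definition delta_add_val (x y : D * A) : D * A :=
  (x.1 + y.1,
   if `[< dioid_lt x.1 y.1 >] then x.2
   else if `[< dioid_lt y.1 x.1 >] then y.2
   else x.2 + y.2).

Definition delta_mul_val (x y : D * A) : D * A := (x.1 * y.1, x.2 * y.2).

Lemma dioid_leE d1 d2 : dioid_le d1 d2 <-> d1 + d2 = d1.
Proof.
split=> [[c <-]|h]; last by exists d1; rewrite addrC.
by rewrite addrAC dioid_addxx.
Qed.

Lemma mregular1 : mregular (1 : D).
Proof. by split=> [|b c]; [apply/eqP; exact: oner_neq0|rewrite !mul1r]. Qed.

Lemma mregularM d1 d2 : mregular d1 -> mregular d2 -> mregular (d1 * d2).
Proof.
move=> [_ r1] [n2 r2]; split=> [h|b c]; last by rewrite -!mulrA => /r1/r2.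
by apply: n2; apply: r1; rewrite h mulr0.
Qed.

Definition keep (b : bool) a : A := if b then a else 0.

Lemma delta_add_valE x y : delta_add_val x y =
  (x.1 + y.1, keep (x.1 + y.1 == x.1) x.2 + keep (x.1 + y.1 == y.1) y.2).
Proof.
rewrite /delta_add_val /keep; congr (_, _).
case: asboolP => [[/dioid_leE -> /eqP n]|h1].
  by rewrite eqxx (negPf n) addr0.
case: asboolP => [[/dioid_leE]|h2].
  by rewrite addrC => -> /eqP n; rewrite eqxx (negPf n) add0r.
have -> : x.1 = y.1.
  by apply: contrapT => n; case: (dioid_le_total x.1 y.1) => h;
    [apply: h1|apply: h2; split=> // /esym].
by rewrite dioid_addxx eqxx.
Qed.

Lemma delta_add_mem x y : delta_mem x -> delta_mem y ->
  delta_mem (delta_add_val x y).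
Proof.
move=> /asboolP hx /asboolP hy; apply/asboolP.
rewrite delta_add_valE /= /keep.
case: (eqVneq (x.1 + y.1) x.1) => [ex|nx];
  case: (eqVneq (x.1 + y.1) y.1) => [ey|ny].
- have e : x.1 = y.1 by rewrite -ex ey.
  rewrite ex; case: hx => [|->]; first by left.
  by case: hy => [|->]; [rewrite -e; left|rewrite addr0; right].
- by rewrite ex addr0.
- by rewrite ey add0r.
- by rewrite addr0; right.
Qed.

Lemma delta_mul_mem x y : delta_mem x -> delta_mem y ->
  delta_mem (delta_mul_val x y).
Proof.
move=> /asboolP [rx|x0] /asboolP [ry|y0]; apply/asboolP => /=.
- by left; apply: mregularM.
- by right; rewrite y0 mulr0.
- by right; rewrite x0 mul0r.
- by right; rewrite x0 mul0r.
Qed.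

Lemma delta_zero_mem : delta_mem (0, 0).
Proof. by apply/asboolP; right. Qed.

Lemma delta_one_mem : delta_mem (1, 1).
Proof. by apply/asboolP; left; apply: mregular1. Qed.

Definition delta_zero : delta := Delta delta_zero_mem.
Definition delta_one : delta := Delta delta_one_mem.
Definition delta_add (x y : delta) : delta :=
  Delta (delta_add_mem (deltaP x) (deltaP y)).
Definition delta_mul (x y : delta) : delta :=
  Delta (delta_mul_mem (deltaP x) (deltaP y)).

Lemma keepD b a1 a2 : keep b (a1 + a2) = keep b a1 + keep b a2.
Proof. by case: b; rewrite /= ?addr0. Qed.

Lemma keep_keep b c a : keep b (keep c a) = keep (b && c) a.
Proof. by case: b; case: c. Qed.

Lemma eqD_l (x y z : D) : (x + y + z == x + y) && (x + y == x) = (x + y + z == x).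
Proof.
apply/andP/eqP => [[/eqP -> /eqP]//|h].
have e : x + y = x by rewrite -{1}h addrAC -(addrA x) dioid_addxx.
by rewrite h e eqxx.
Qed.

Lemma delta_addC : commutative delta_add.
Proof.
move=> x y; apply: val_inj => /=; rewrite !delta_add_valE.
by congr (_, _); rewrite 1?[LHS]addrC // (addrC (val y).1).
Qed.

Lemma delta_addA : associative delta_add.
Proof.
move=> [[x a] px] [[y b] py] [[z c] pz]; apply: val_inj => /=.
rewrite !delta_add_valE /=; congr (_, _); first by rewrite addrA.
rewrite !keepD !keep_keep eqD_l (addrA x y z) [LHS]addrA.
congr (keep _ a + keep _ b + keep _ c).
- have -> : x + y + z = y + z + x by rewrite -addrA addrC.
  by rewrite eqD_l (addrC x y) addrAC eqD_l.
- have -> : x + y + z = z + y + x by rewrite -addrA addrC (addrC y).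
  by rewrite (addrC y z) eqD_l.
Qed.

Lemma delta_add0 : left_id delta_zero delta_add.
Proof.
move=> [[x a] px]; apply: val_inj => /=; rewrite delta_add_valE /= add0r eqxx.
by congr (_, _); rewrite /keep if_same add0r.
Qed.

HB.instance Definition _ :=
  GRing.isNmodule.Build delta delta_addA delta_addC delta_add0.

Lemma delta_mulA : associative delta_mul.
Proof.
by move=> x y z; apply: val_inj; rewrite /= /delta_mul_val /= !mulrA.
Qed.

Lemma delta_mulC : commutative delta_mul.
Proof.
move=> x y; apply: val_inj; rewrite /= /delta_mul_val.
by rewrite (mulrC (val x).1) (mulrC (val x).2).
Qed.

Lemma delta_mul1 : left_id delta_one delta_mul.
Proof.
by move=> [[x a] px]; apply: val_inj; rewrite /= /delta_mul_val /= !mul1r.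
Qed.

Lemma delta_mul0 : left_zero (0 : delta) delta_mul.
Proof.
by move=> [[x a] px]; apply: val_inj; rewrite /= /delta_mul_val /= !mul0r.
Qed.

Lemma delta_mulDl : left_distributive delta_mul +%R.
Proof.
move=> [[x a] px] [[y b] py] [[z c] pz]; apply: val_inj => /=.
rewrite /delta_mul_val !delta_add_valE /=; congr (_, _); first exact: mulrDl.
case/asboolP: pz => /= [[_ rz]|->].
  have inj u v : (u * z == v * z) = (u == v).
    apply/eqP/eqP => [|->//].
    by rewrite !(mulrC _ z) => /rz.
  rewrite -mulrDl !inj [LHS]mulrDl.
  by congr (_ + _); rewrite /keep; case: ifP; rewrite ?mul0r.
by rewrite !mulr0 /keep !if_same addr0.
Qed.

Lemma delta_one_neq0 : delta_one != 0.
Proof.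
apply/eqP => /(congr1 (fun u => (delta_val u).1)) /= /eqP.
by rewrite (negPf (oner_neq0 _)).
Qed.

HB.instance Definition _ := GRing.Nmodule_isComNzSemiRing.Build delta
  delta_mulA delta_mulC delta_mul1 delta_mulDl delta_mul0 delta_one_neq0.

End DeltaProduct.

Section DeltaDioid.
Variables (D1 D2 : ctiDioidType).
Local Notation D12 := (delta D1 D2).

Lemma delta_addxx (x : D12) : x + x = x.
Proof.
case: x => [[x a] px]; apply: val_inj => /=.
by rewrite delta_add_valE /keep /= dioid_addxx eqxx dioid_addxx.
Qed.

Lemma delta_le_po : is_partial_order (@dioid_le D12).
Proof.
have leE (x y : D12) : dioid_le x y -> x + y = x.
  by case=> c <-; rewrite addrAC delta_addxx.
split=> [x|x y /leE h1 /leE h2|x y z [c <-] [d <-]].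
- by exists 0; rewrite addr0.
- by rewrite -h1 addrC h2.
- by exists (d + c); rewrite addrA.
Qed.

Lemma delta_le_total (x y : D12) : dioid_le x y \/ dioid_le y x.
Proof.
suff: x + y = x \/ x + y = y.
  by case=> h; [left; exists x; rewrite addrC|right; exists y].
case: x y => [[x a] px] [[y b] py].
case: (dioid_le_total x y) => /dioid_leE h.
  case: (eqVneq x y) => [e|n].
    case: (dioid_le_total a b) => /dioid_leE k; [left|right]; apply: val_inj;
      rewrite /= delta_add_valE /keep /= -e dioid_addxx eqxx /= ?k //.
    by rewrite addrC k.
  left; apply: val_inj.
  by rewrite /= delta_add_valE /keep /= h eqxx (negPf n) /= addr0.
case: (eqVneq x y) => [e|n].
  case: (dioid_le_total a b) => /dioid_leE k; [left|right]; apply: val_inj;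
    rewrite /= delta_add_valE /keep /= -e dioid_addxx eqxx /= ?k //.
  by rewrite addrC k.
right; apply: val_inj.
by rewrite /= delta_add_valE /keep /= addrC h eqxx eq_sym (negPf n) /= add0r.
Qed.

HB.instance Definition _ := NzSemiRing_isDioid.Build D12 delta_le_po.
HB.instance Definition _ :=
  Dioid_isTotalIdempotent.Build D12 delta_addxx delta_le_total.

End DeltaDioid.

Section Reassociation.
Variables (D1 D2 : ctiDioidType) (A : comNzSemiRingType).

Definition reassoc (t : (D1 * D2) * A) : D1 * (D2 * A) :=
  (t.1.1, (t.1.2, t.2)).

(* the inclusions of the two iterated delta products into the full products;
   both are injective, delta being a subtype *)
Definition delta_incl_l (x : delta (delta D1 D2) A) : (D1 * D2) * A :=
  (delta_val (delta_val x).1, (delta_val x).2).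

Definition delta_incl_r (y : delta D1 (delta D2 A)) : D1 * (D2 * A) :=
  ((delta_val y).1, delta_val (delta_val y).2).

End Reassociation.

(* Main.v *)
(* The point is that a pair (d1, d2) is regular in D1 Delta D2 iff both
   components are: (d1, oo) has the same product with (0, 0) and with (0, oo), so a
   regular pair has d2 <> oo, which forces d1 to be regular.  Both carriers are then
   described by the same conditions on (d1, d2, a), and both additions are the
   lexicographic one.  (Here oo and 0 are the ring 0 and 1 of the formulas.) *)
Require Import Defs.
From HB Require Import structures.
From mathcomp Require Import all_boot all_algebra.
From mathcomp Require Import boolp classical_sets.

Import GRing.Theory.
Local Open Scope ring_scope.
Local Open Scope classical_set_scope.

Lemma delta_val_add (D : ctiDioidType) (A : comNzSemiRingType) (x y : delta D A) :
  delta_val (x + y) = delta_add_val (delta_val x) (delta_val y).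
Proof. by []. Qed.

Lemma mregular_delta (D1 D2 : ctiDioidType) (x : delta D1 D2) :
  mregular x <-> mregular (delta_val x).1 /\ mregular (delta_val x).2.
Proof.
case: x => [[d1 d2] p] /=; split=> [[_ rx]|[[n1 r1] [n2 r2]]].
  (* The first component [1] is regular and so admits every second component; multiplying by such
     pairs tests cancellation in [D2] alone. *)
  have m1 (b : D2) : delta_mem ((1 : D1), b).
    by apply/asboolP; left; apply: mregular1.
  have r2 b c : d2 * b = d2 * c -> b = c.
    move=> e; suff /rx [] : Delta p * Delta (m1 b) = Delta p * Delta (m1 c) by [].
    by apply: val_inj; rewrite /= /delta_mul_val /= e.
  have n2 : d2 <> 0.
    move=> d20; move: (r2 1 0); rewrite d20 !mul0r => /(_ erefl)/eqP.
    by apply/negP; exact: oner_neq0.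
  by case/asboolP: (p).
split=> [/(congr1 (fun u => (delta_val u).1))//|[[b1 b2] pb] [[c1 c2] pc]].
by case/(congr1 (@delta_val _ _)) => /= /r1 e1 /r2 e2; apply: val_inj; rewrite /= e1 e2.
Qed.

Section Reassociation.
Variables (D1 D2 : ctiDioidType) (A : comNzSemiRingType).
Implicit Types (x : delta (delta D1 D2) A) (y : delta D1 (delta D2 A)).

(** The conjuncts are the membership conditions of the inner and the outer pair, the latter split by
    [mregular_delta]; in this form the two carriers can be compared propositionally. *)
Lemma delta_incl_l_imageP (t : D1 * (D2 * A)) :
  (exists x, reassoc (delta_incl_l x) = t) <->
  (mregular t.1 \/ t.2.1 = 0) /\ (mregular t.1 /\ mregular t.2.1 \/ t.2.2 = 0).
Proof.
split=> [[[[[[d1 d2] p] a] q] <-]|].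
  by case/asboolP: (q) => /= [/mregular_delta|]; move/asboolP: (p) => /=; tauto.
case: t => [d1 [d2 a]] /= [/asboolP p q].
pose d12 : delta D1 D2 := @Delta D1 D2 (d1, d2) p.
have m : delta_mem (d12, a) by apply/asboolP; rewrite /= mregular_delta.
by exists (Delta m).
Qed.

(** Here the inner pair lies in the second slot, and [(0, 0)] is the zero of [delta D2 A]. *)
Lemma delta_incl_r_imageP (t : D1 * (D2 * A)) :
  (exists y, delta_incl_r y = t) <->
  (mregular t.2.1 \/ t.2.2 = 0) /\ (mregular t.1 \/ t.2 = (0, 0)).
Proof.
split=> [[[[d1 [[d2 a] p]] q] <-]|].
  split; first exact/asboolP.
  by case/asboolP: (q) => /= [|/(congr1 (@delta_val _ _))]; tauto.
case: t => [d1 [d2 a]] /= [/asboolP p q].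
pose d2a : delta D2 A := @Delta D2 A (d2, a) p.
have m : delta_mem (d1, d2a).
  by apply/asboolP; case: q => [|e]; [left|right; apply: val_inj].
by exists (Delta m).
Qed.

Lemma range_delta_incl :
  range (fun x => reassoc (delta_incl_l x)) = range (@delta_incl_r D1 D2 A).
Proof.
apply/seteqP; split=> t [u _ e].
  have /delta_incl_l_imageP h : exists x, reassoc (delta_incl_l x) = t by exists u.
  suff /delta_incl_r_imageP [y <-] : (mregular t.2.1 \/ t.2.2 = 0) /\
    (mregular t.1 \/ t.2 = (0, 0)) by exists y.
  (* If neither hypothesis gives [d1] regular, then [d2] and [a] are both [0], so the inner pair is
     zero. *)
  by case: {e} t h => [d1 [d2 a]] /= [[?|->] [[? ?]|->]]; tauto.
have /delta_incl_r_imageP h : exists y, delta_incl_r y = t by exists u.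
suff /delta_incl_l_imageP [x <-] : (mregular t.1 \/ t.2.1 = 0) /\
  (mregular t.1 /\ mregular t.2.1 \/ t.2.2 = 0) by exists x.
by case: {e} t h => [d1 [d2 a]] /= [? [?|[-> ->]]]; tauto.
Qed.

(** In the [keep] form, [a] survives on the left if the pair [(d1, d2)] attains the minimum, on the
    right if [d1] does and then [d2] does. *)
Lemma delta_incl_add x x' y y' :
  reassoc (delta_incl_l x) = delta_incl_r y ->
  reassoc (delta_incl_l x') = delta_incl_r y' ->
  reassoc (delta_incl_l (x + x')) = delta_incl_r (y + y').
Proof.
case: x x' => [[[[d1 d2] p] a] q] [[[[d1' d2'] p'] a'] q'].
case: y y' => [[e1 [[e2 b] r]] s] [[e1' [[e2' b'] r']] s'].
rewrite /reassoc /delta_incl_l /delta_incl_r !delta_val_add !delta_add_valE /=.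
move=> -[? ? ?] [? ? ?]; subst e1 e2 b e1' e2' b'.
congr (_, _).
(* Turns the test on pairs into a conjunction of tests in [D1] and [D2]. *)
have valE (u v : delta D1 D2) : (u == v) = (delta_val u == delta_val v) by [].
rewrite !valE !delta_val_add !delta_add_valE /= !xpair_eqE.
(* A tie in [D1] leaves the same tests in [D2] on both sides. Otherwise a discarded entry is [0], so
   a test in [D2] against it selects between [0] and [0]. The impossible case of no minimum gives
   zeros on both sides. *)
case: (eqVneq (d1 + d1') d1) => _; case: (eqVneq (d1 + d1') d1') => _ //=;
  by rewrite /keep ?addr0 ?add0r ?eqxx ?if_same ?addr0 ?add0r.
Qed.

End Reassociation.

Theorem theorem5 (D1 D2 : ctiDioidType) (A : comNzSemiRingType) :
  let L := delta (delta D1 D2) A in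
  let R := delta D1 (delta D2 A) in
  let iL := fun x : L => reassoc (delta_incl_l x) in
  let iR := fun y : R => delta_incl_r y in
  [/\ range iL = range iR,
      forall (x x' : L) (y y' : R),
        iL x = iR y -> iL x' = iR y' -> iL (x + x') = iR (y + y'),
      forall (x x' : L) (y y' : R),
        iL x = iR y -> iL x' = iR y' -> iL (x * x') = iR (y * y'),
      iL 0 = iR 0
    & iL 1 = iR 1].
Proof.
split=> //; [exact: range_delta_incl|exact: delta_incl_add|].
(* Products are componentwise in both bracketings. *)
move=> [[[[d1 d2] p] a] q] [[[[d1' d2'] p'] a'] q'].
move=> [[e1 [[e2 b] r]] s] [[e1' [[e2' b'] r']] s'].
by rewrite /reassoc /delta_incl_l /delta_incl_r /= => -[-> -> ->] [-> -> ->].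
Qed.
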